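(* Let $\rho_{12}$ be a density matrix of two qubits $a_1,a_2$, i.e. a positive semidefinite operator of trace $1$ on $\mathbb{C}^2\otimes\mathbb{C}^2$ (first factor for $a_1$, second for $a_2$). Let $\sigma_0=I$ and let $\sigma_1,\sigma_2,\sigma_3$ be the standard Pauli operators on $\mathbb{C}^2$. Let $S(a_2,a_1)$ be the $4\times 4$ matrix (link transformation) with entries $$S(a_2,a_1)_{nm}=\tfrac12\,\mathrm{tr}\big[\rho_{12}\,(\sigma_m\otimes\sigma_n)\big],\qquad n,m\in\{0,1,2,3\},$$ where $\sigma_m$ acts on qubit $a_1$ and $\sigma_n$ on qubit $a_2$. Fix any orthonormal basis $|0\rangle,|1\rangle$ of $\mathbb{C}^2$, used for both qubits, and let $U$ be the $4\times4$ matrix with rows indexed by pairs $(j,i)\in\{0,1\}^2$ and columns indexed by $m\in\{0,1,2,3\}$, with entries $$U_{ji;m}=\tfrac{1}{\sqrt2}\,\langle j|\sigma_m|i\rangle .$$ Then $U$ is unitary and $$S(a_2,a_1)=U^{\dagger}\,\mathcal{R}(\rho_{21}^{T_1})\,U,$$ where $\mathcal{R}(\rho_{21}^{T_1})$ is the realignment of the partial transpose, with respect to subsystem $a_1$, of $\rho_{21}$, computed in the chosen basis.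
   Context: Here $\rho_{21}$ denotes the same two-qubit state as $\rho_{12}$ but with the tensor factors written in the order ($a_2$, $a_1$): $(\rho_{21})_{i\alpha;j\beta}=(\rho_{12})_{\alpha i;\beta j}$, where $M_{i\alpha;j\beta}=\langle i|\langle\alpha|M|j\rangle|\beta\rangle$. Partial transpose on $a_1$ (the second factor of $\rho_{21}$): $(\rho_{21}^{T_1})_{i\alpha;j\beta}=(\rho_{21})_{i\beta;j\alpha}$. Realignment: for a matrix $M$ with entries $M_{i\alpha;j\beta}$, where $i,j$ index the first tensor factor and $\alpha,\beta$ the second, $\mathcal{R}(M)$ is the matrix with rows indexed by pairs $(i,j)$ and columns indexed by pairs $(\alpha,\beta)$, with $\mathcal{R}(M)_{ij;\alpha\beta}=M_{i\alpha;j\beta}$. Thus $\mathcal{R}(\rho_{21}^{T_1})_{ij;\alpha\beta}=(\rho_{21})_{i\beta;j\alpha}$. In the product $U^\dagger\mathcal{R}(\rho_{21}^{T_1})U$, the row-pair index and the column-pair index of $\mathcal{R}(\rho_{21}^{T_1})$ are both identified with the row index set $\{0,1\}^2$ of $U$. *)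

(* Defs.v *)
From HB Require Import structures.
From mathcomp Require Import all_boot all_order all_algebra.
From mathcomp Require Import reals complex mxtens.
Set Implicit Arguments.
Unset Strict Implicit.
Unset Printing Implicit Defensive.
Import Order.TTheory GRing.Theory Num.Theory.
Local Open Scope ring_scope.
Local Open Scope sesquilinear_scope.

Section Qubits.
Variable C : numClosedFieldType.

Definition is_density n (D : 'M[C]_n) : Prop :=
  [/\ D \is hermsymmx,
      forall v : 'cV[C]_n, 0 <= (v^t* *m D *m v) ord0 ord0
    & \tr D = 1].

Definition mx22 (a b c d : C) : 'M[C]_2 :=
  \matrix_(i < 2, j < 2)
    if i == ord0 then (if j == ord0 then a else b)
    else (if j == ord0 then c else d).

Definition pauli (m : 'I_4) : 'M[C]_2 :=
  match val m with
  | 0 => 1%:M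
  | 1 => mx22 0 1 1 0
  | 2 => mx22 0 (- 'i) 'i 0
  | _ => mx22 1 0 0 (-1)
  end.

(* Two orthonormal vectors of C^2 span, so no spanning clause is needed. *)
Definition orthonormal_basis (e : 'I_2 -> 'cV[C]_2) : Prop :=
  forall i j, ((e i)^t* *m e j) ord0 ord0 = (i == j)%:R.

(* A pair of bits (i, a) is encoded as [mxtens_index (i, a) : 'I_(2 * 2)], the
   index convention of the Kronecker product [*t]; [entry M i a j b] is the
   entry M_(i a ; j b) and [mx4 F] is the matrix with these entries. *)
Definition entry (M : 'M[C]_(2 * 2)) (i a j b : 'I_2) : C :=
  M (mxtens_index (i, a)) (mxtens_index (j, b)).

Definition mx4 (F : 'I_2 -> 'I_2 -> 'I_2 -> 'I_2 -> C) : 'M[C]_(2 * 2) :=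
  \matrix_(p, q) F (mxtens_unindex p).1 (mxtens_unindex p).2
                   (mxtens_unindex q).1 (mxtens_unindex q).2.

(* M_(i a ; j b) = <i|<a| M |j>|b> in the product basis built from e. *)
Definition in_basis (e : 'I_2 -> 'cV[C]_2) (M : 'M[C]_(2 * 2)) :=
  mx4 (fun i a j b =>
         ((e i *t e a)^t* *m M *m (e j *t e b)) ord0 ord0).

(* Exchange of the two tensor factors.  It is written in the standard basis
   but does not depend on it: see [entry_swap_in_basis]. *)
Definition swapmx (M : 'M[C]_(2 * 2)) :=
  mx4 (fun i a j b => entry M a i b j).

(* Partial transpose on the second tensor factor. *)
Definition ptranspose2 (M : 'M[C]_(2 * 2)) :=
  mx4 (fun i a j b => entry M i b j a).

(* Rows are indexed by (i, j), columns by (a, b). *)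
Definition realign (M : 'M[C]_(2 * 2)) :=
  mx4 (fun i j a b => entry M i a j b).

Definition link (rho12 : 'M[C]_(2 * 2)) : 'M[C]_4 :=
  \matrix_(n, m) (2^-1 * \tr (rho12 *m (pauli m *t pauli n))).

(* Row p encodes the pair (j, i): the entry is <j| sigma_m |i> / sqrt 2. *)
Definition Umx (e : 'I_2 -> 'cV[C]_2) : 'M[C]_(2 * 2, 4) :=
  \matrix_(p, m)
    ((sqrtC 2)^-1 *
     ((e (mxtens_unindex p).1)^t* *m pauli m *m e (mxtens_unindex p).2)
       ord0 ord0).

Lemma entry_mx4 F i a j b : entry (mx4 F) i a j b = F i a j b.
Proof. by rewrite /entry mxE !mxtens_indexK. Qed.

Lemma entry_swap_in_basis e M i a j b :
  entry (in_basis e (swapmx M)) i a j b = entry (in_basis e M) a i b j.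
Proof.
pose tau (p : 'I_(2 * 2)) : 'I_(2 * 2) :=
  mxtens_index ((mxtens_unindex p).2, (mxtens_unindex p).1).
have tauK : involutive tau.
  move=> p; rewrite /tau mxtens_indexK -[RHS]mxtens_unindexK.
  by case: (mxtens_unindex p).
have ketE (k l : 'I_2) p z : (e k *t e l) (tau p) z = (e l *t e k) p z.
  rewrite !mxE /tau !mxtens_indexK mulrC.
  by rewrite !(ord1 (mxtens_unindex z).1) !(ord1 (mxtens_unindex z).2).
have swapE p q : swapmx M (tau p) (tau q) = M p q.
  rewrite mxE /tau !mxtens_indexK /entry.
  rewrite -[in RHS](mxtens_unindexK p) -[in RHS](mxtens_unindexK q).
  by case: (mxtens_unindex p) (mxtens_unindex q) => [k l] [].
rewrite !entry_mx4 !mxE (reindex_inj (can_inj tauK)) /=.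
apply: eq_bigr => q _; rewrite ketE; congr (_ * _).
rewrite !mxE (reindex_inj (can_inj tauK)) /=.
by apply: eq_bigr => p _; rewrite swapE mxE mxE ketE !mxE.
Qed.

End Qubits.

(* Main.v *)
Require Import Defs.
From mathcomp Require Import all_boot all_order all_algebra.
From mathcomp Require Import reals complex mxtens.
Import Order.TTheory GRing.Theory Num.Theory.
Local Open Scope ring_scope.
Local Open Scope complex_scope.
Local Open Scope sesquilinear_scope.

(** Let [E] be the unitary matrix whose columns are the basis vectors, so that
    <j|A|i> is the entry (j, i) of [E^t* *m A *m E].  Since the Pauli matrices
    are hermitian, the entries (n, m) of [U^t* *m U] and of
    [U^t* *m realign _ *m U] are, up to the factor 1/2, coordinate expansions
    in this basis of tr(sigma_n sigma_m) and of tr(rho (sigma_m (x) sigma_n)),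
    and the trace does not depend on the basis. *)

Section LinkTransformation.
Variable C : numClosedFieldType.
Implicit Types (e : 'I_2 -> 'cV[C]_2) (A B : 'M[C]_2) (M : 'M[C]_(2 * 2)).

Lemma sum_mxtens_index (V : nmodType) m n (F : 'I_(m * n) -> V) :
  \sum_p F p = \sum_i \sum_j F (mxtens_index (i, j)).
Proof.
rewrite pair_bigA (reindex (@mxtens_index m n)) /=.
  by apply: eq_bigr => -[].
exists (@mxtens_unindex m n) => p _; [exact: mxtens_indexK|exact: mxtens_unindexK].
Qed.

Lemma trmxC_mul m n p (A : 'M[C]_(m, n)) (B : 'M[C]_(n, p)) :
  (A *m B)^t* = B^t* *m A^t*.
Proof. by rewrite trmx_mul map_mxM. Qed.

(** As [E] is square, it is also a right inverse of its adjoint. This cancels the pair between [A]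
    and [B] and, by cyclicity of the trace, the outer pair. *)
Lemma mxtrace_unitary_conj n (E A B : 'M[C]_n) : E^t* *m E = 1%:M ->
  \tr (E^t* *m A *m E *m (E^t* *m B *m E)) = \tr (A *m B).
Proof.
move=> /mulmx1C EE; rewrite -!mulmxA (mulmxA E) EE mul1mx mxtrace_mulC.
by rewrite -!mulmxA EE mulmx1.
Qed.

Lemma mxtrace_mulE n (A B : 'M[C]_n) :
  \tr (A *m B) = \sum_i \sum_j A i j * B j i.
Proof. by apply: eq_bigr => i _; rewrite mxE. Qed.

Definition basis_mx e : 'M[C]_2 := \matrix_(k, i) e i k ord0.

Lemma basis_mxE e A i j :
  ((basis_mx e)^t* *m A *m basis_mx e) i j =
  ((e i)^t* *m A *m e j) ord0 ord0.
Proof.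
rewrite !mxE; apply: eq_bigr => k _; rewrite !mxE; congr (_ * _).
by apply: eq_bigr => l _; rewrite !mxE.
Qed.

Lemma orthonormal_basis_mx e :
  orthonormal_basis e -> (basis_mx e)^t* *m basis_mx e = 1%:M.
Proof.
move=> eP; apply/matrixP => i j; rewrite [RHS]mxE -eP !mxE.
by apply: eq_bigr => k _; rewrite !mxE.
Qed.

Lemma tens_orthonormal n (E : 'M[C]_n) : E^t* *m E = 1%:M ->
  (E *t E)^t* *m (E *t E) = 1%:M.
Proof.
move=> EE; rewrite trmx_tens map_mxT tensmx_mul EE.
apply/matrixP => p q; case: (mxtens_indexP p) => i a.
case: (mxtens_indexP q) => j b; rewrite tensmxE !mxE -natrM mulnb.
by rewrite (can_eq (@mxtens_indexK n n)) xpair_eqE.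
Qed.

Lemma entry_in_basis e M i a j b :
  entry (in_basis e M) i a j b =
  ((basis_mx e *t basis_mx e)^t* *m M *m (basis_mx e *t basis_mx e))
    (mxtens_index (i, a)) (mxtens_index (j, b)).
Proof.
rewrite entry_mx4 !mxE; apply: eq_bigr => q _.
rewrite !mxE !mxtens_indexK !(ord1 (_ : 'I_1)) /=; congr (_ * _).
apply: eq_bigr => p _.
by rewrite !mxE !mxtens_indexK !(ord1 (_ : 'I_1)).
Qed.

Lemma mx22_trmxC (a b c d : C) :
  (mx22 a b c d)^t* = mx22 a^* c^* b^* d^*.
Proof. by apply/matrixP => i j; rewrite !mxE; do 2!case: eqP. Qed.

Lemma pauli_herm m : (pauli C m)^t* = pauli C m.
Proof.
case: m => -[|[|[|[|//]]]] ?; rewrite /pauli /=.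
- by rewrite trmx1 map_mx1.
- by rewrite mx22_trmxC rmorph0 rmorph1.
- by rewrite mx22_trmxC rmorphN rmorph0 /= conjCi opprK.
- by rewrite mx22_trmxC rmorphN rmorph0 /= rmorph1.
Qed.

(** Hilbert-Schmidt orthogonality of the Pauli matrices; the two factors 1/sqrt 2 in [Umx]
    compensate the norm 2. *)
Lemma mxtrace_pauli_mul n m :
  \tr (pauli C n *m pauli C m) = 2 * (n == m)%:R.
Proof.
rewrite mxtrace_mulE !big_ord_recl !big_ord0.
case: n => -[|[|[|[|//]]]] ?; case: m => -[|[|[|[|//]]]] ?;
  rewrite /pauli /= !mxE /= ?mulrN ?mulNr ?mulCii ?opprK
    ?(mulr0, mul0r, mulr1, mul1r, addr0, add0r, oppr0) ?mulr2n ?addr0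
    ?subrr ?addNr //.
Qed.

Lemma UmxE e j i m :
  Umx e (mxtens_index (j, i)) m =
  (sqrtC 2)^-1 * ((basis_mx e)^t* *m pauli C m *m basis_mx e) j i.
Proof. by rewrite mxE mxtens_indexK basis_mxE. Qed.

Lemma herm_mxE n (K : 'M[C]_n) i j : K^t* = K -> ((K j i)^*)%R = K i j.
Proof. by move=> {2}<-; rewrite !mxE. Qed.

(** The conjugated Pauli matrix is hermitian, so complex conjugation of its entry (j, i) only swaps
    the indices. The resulting order i, j lets the sums below close up into traces. *)
Lemma UmxC_E e j i n :
  (Umx e)^t* n (mxtens_index (j, i)) =
  (sqrtC 2)^-1 * ((basis_mx e)^t* *m pauli C n *m basis_mx e) i j.
Proof.
rewrite mxE mxE UmxE rmorphM fmorphV /= conj_Creal ?ger0_real ?sqrtC_ge0 //.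
congr (_ * _); apply: herm_mxE.
by rewrite !trmxC_mul pauli_herm trmxCK mulmxA.
Qed.

Lemma sqrtC2V_mul : (sqrtC 2)^-1 * (sqrtC 2)^-1 = 2^-1 :> C.
Proof. by rewrite -invfM -expr2 sqrtCK. Qed.

Lemma Umx_unitary e : orthonormal_basis e -> Umx e \is unitarymx.
Proof.
move=> /orthonormal_basis_mx EE; apply/unitarymxP.
(* [unitarymxP] asks for the product in the other order; [2 * 2] is convertible to 4, so [Umx e]
   counts as square. *)
suff /(@mulmx1C _ 4) : (Umx e)^t* *m Umx e = 1%:M by [].
apply/matrixP => n m.
rewrite [LHS]mxE sum_mxtens_index exchange_big /=.
under eq_bigr => i _ do under eq_bigr => j _ do
  rewrite UmxC_E UmxE mulrACA sqrtC2V_mul.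
under eq_bigr => i _ do rewrite -mulr_sumr.
rewrite -mulr_sumr -mxtrace_mulE mxtrace_unitary_conj //.
by rewrite mxtrace_pauli_mul mulKf ?pnatr_eq0 // mxE.
Qed.

(** Write K_m for [pauli C m] conjugated by E. Both sides are half the sum over b, j, a, i of Q_(bj;
    ai) (K_m)_(ab) (K_n)_(ij), with Q the matrix of [M] in the product basis. *)
Lemma link_Umx e M : orthonormal_basis e ->
  link M =
  (Umx e)^t* *m realign (ptranspose2 (in_basis e (swapmx M))) *m Umx e.
Proof.
move=> /orthonormal_basis_mx EE; apply/matrixP => n m.
rewrite [LHS]mxE -(mxtrace_unitary_conj _ _ _ _ (tens_orthonormal _ _ EE)).
set E := basis_mx e; set F := E *t E; set Q := _ *m M *m F.
have -> : F^t* *m (pauli C m *t pauli C n) *m F =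
    (E^t* *m pauli C m *m E) *t (E^t* *m pauli C n *m E).
  by rewrite /F trmx_tens map_mxT !tensmx_mul.
rewrite mxtrace_mulE sum_mxtens_index mulr_sumr.
(* The sums on the right are reordered to b, j, a, i, the order produced by the trace on the
   left. *)
rewrite [RHS]mxE sum_mxtens_index exchange_big /=; apply: eq_bigr => b _.
rewrite mulr_sumr.
under [RHS]eq_bigr => a _ do rewrite mxE sum_mxtens_index mulr_suml.
rewrite [RHS]exchange_big /=.
apply: eq_bigr => j _.
rewrite sum_mxtens_index mulr_sumr; apply: eq_bigr => a _.
rewrite mulr_sumr mulr_suml; apply: eq_bigr => i _.
rewrite UmxC_E UmxE -/E tensmxE.
(* Realignment, partial transpose and swap move the indices in turn: (ji; ab) to (ja; ib) to (jb;
   ia) to (bj; ai). *)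
have -> : realign (ptranspose2 (in_basis e (swapmx M)))
    (mxtens_index (j, i)) (mxtens_index (a, b)) =
    Q (mxtens_index (b, j)) (mxtens_index (a, i)).
  rewrite -[LHS]/(entry _ j i a b) 2!entry_mx4 entry_swap_in_basis.
  by rewrite entry_in_basis.
rewrite -sqrtC2V_mul [RHS]mulrAC [X in _ = X * _]mulrACA -[RHS]mulrA.
by congr (_ * _); rewrite mulrC; congr (_ * _); apply: mulrC.
Qed.

End LinkTransformation.

Theorem mainTheorem1 (R : realType) (rho12 : 'M[R[i]]_(2 * 2))
    (e : 'I_2 -> 'cV[R[i]]_2) :
  is_density rho12 -> orthonormal_basis e ->
  Umx e \is unitarymx /\
  link rho12 =
    (Umx e)^t* *m realign (ptranspose2 (in_basis e (swapmx rho12))) *m Umx e.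
Proof.
move=> _ eP; split; [exact: Umx_unitary | exact: link_Umx].
Qed.
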